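(* For every integer $N\ge 2$, the following relation holds in the Hecke algebra $H_{N+1}(q)$: $$\bigl([2]^2+1\bigr)\,\mathsf T_N \mathsf P_N \mathsf T_N = \frac{[2]\bigl([N+2]+2[N]\bigr)}{[N]}\,\mathsf T_N \mathsf P_{N-1} - \frac{[N-1]}{[N]}\,\mathsf P_{N-1}\mathsf T_N \mathsf T_{N-1}\mathsf T_N \mathsf T_{N-1}\mathsf T_N \mathsf P_{N-1}.$$
   Context: The Hecke algebra $H_N(q)$ is the unital associative algebra over $\mathbb C(q)$ ($q$ an indeterminate) with generators $\mathsf R_1,\ldots,\mathsf R_{N-1}$ and relations $\mathsf R_k^2 = \mathsf 1 + (q-q^{-1})\mathsf R_k$ for $1\le k\le N-1$; $\mathsf R_k \mathsf R_m \mathsf R_k = \mathsf R_m \mathsf R_k \mathsf R_m$ for $|k-m|=1$; $\mathsf R_k \mathsf R_m = \mathsf R_m \mathsf R_k$ for $|k-m|\ge 2$. Elements of $H_N(q)$ are regarded as elements of $H_{N+1}(q)$ via $\mathsf R_k\mapsto \mathsf R_k$. Put $\mathsf T_k = q^{-1}\cdot\mathsf 1+\mathsf R_k$. For $k\in\mathbb Z$, $[k] = \frac{q^k-q^{-k}}{q-q^{-1}}$. The $q$-antisymmetrizer $\mathsf P_N\in H_N(q)$ is defined recursively by $\mathsf P_1=\mathsf 1$ and $$\mathsf P_{N+1} = \frac{1}{[N+1]}\,\mathsf P_N\bigl(q^N - [N]\,\mathsf R_N\bigr)\mathsf P_N ,$$ equivalently $\mathsf P_{N+1}=\mathsf P_N-\frac{[N]}{[N+1]}\mathsf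 P_N\mathsf T_N\mathsf P_N$. *)

(* Defs.v *)
From HB Require Import structures.
From mathcomp Require Import all_boot all_order all_algebra finmap.
From mathcomp Require Import generic_quotient boolp reals complex.
From mathcomp Require Import monalg.

Set Implicit Arguments.
Unset Strict Implicit.
Unset Printing Implicit Defensive.

Import GRing.Theory.

Local Open Scope ring_scope.
Local Open Scope quotient_scope.

(* The free associative algebra: monoid algebra of the words over I. *)
Notation free_alg K I := {malg K[{fmonom I}]}.

Definition free_var {K : fieldType} {I : choiceType} (i : I) : free_alg K I :=
  << fmu i >>.

Section FreeAlgebra.
Context (K : fieldType) (I : choiceType).

Lemma free_scalerAr (c : K) (x y : free_alg K I) : c *: (x * y) = x * (c *: y).
Proof.
apply/malgP => m; rewrite mcoeffZ.
rewrite [RHS](mcoeffMrw (g1 := x) m (fsubset_refl _) (msuppZ_le c y)).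
rewrite mcoeffMr mulr_sumr.
apply: eq_bigr => k1 _; rewrite mulr_sumr.
by apply: eq_bigr => k2 _; rewrite mcoeffZ mulrnAr mulrCA.
Qed.

Context (B : algType K) (h : I -> B).

Definition free_monom_eval (m : {fmonom I}) : B :=
  \prod_(i <- fmonom_val m) h i.

Lemma free_monom_eval_mmorphism : mmorphism free_monom_eval.
Proof.
split=> [x y|]; rewrite /free_monom_eval; last by rewrite fm1 big_nil.
by rewrite fmM big_cat.
Qed.

HB.instance Definition _ :=
  isMultiplicative.Build _ _ free_monom_eval free_monom_eval_mmorphism.

Definition free_eval : free_alg K I -> B := mmap (in_alg B) free_monom_eval.

Lemma free_eval_zmod : zmod_morphism free_eval.
Proof. by move=> x y; rewrite /free_eval raddfB. Qed.

HB.instance Definition _ := GRing.isZmodMorphism.Build _ _ free_eval free_eval_zmod.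

Lemma free_eval_monoid : monoid_morphism free_eval.
Proof.
have C : forall (g : free_alg K I) m m',
    GRing.comm (in_alg B g@_m) (free_monom_eval m').
  by move=> g m m'; rewrite /GRing.comm /= mulr_algl mulr_algr.
have [M1 M2] := commr_mmap_is_multiplicative C.
by split.
Qed.

HB.instance Definition _ :=
  GRing.isMonoidMorphism.Build _ _ free_eval free_eval_monoid.

Lemma free_evalM x y : free_eval (x * y) = free_eval x * free_eval y.
Proof. exact: rmorphM. Qed.

Lemma free_eval_scalable : scalable free_eval.
Proof. by move=> c x; rewrite /free_eval mmapZ /= mulr_algl. Qed.

HB.instance Definition _ :=
  GRing.isScalable.Build K _ _ *:%R free_eval free_eval_scalable.

Lemma free_eval_var i : free_eval (free_var i) = h i.
Proof.
rewrite /free_eval mmapU /= scale1r mul1r.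
by rewrite /free_monom_eval fmU big_seq1.
Qed.

Lemma free_eval2 i j : free_eval (free_var i * free_var j) = h i * h j.
Proof. by rewrite -(free_eval_var i) -(free_eval_var j); apply: free_evalM. Qed.

Lemma free_eval3 i j k :
  free_eval (free_var i * free_var j * free_var k) = h i * h j * h k.
Proof. by rewrite -free_eval2 -(free_eval_var k); apply: free_evalM. Qed.

End FreeAlgebra.

Local Opaque free_var free_eval.

Section Hecke.
Context (K : fieldType) (q : K).

Definition qnum (k : int) : K := (q ^ k - q ^ (- k)) / (q - q^-1).

Definition hecke_index (N : nat) : choiceType := {k : nat | (0 < k < N)%N}.

Local Notation F N := (free_alg K (hecke_index N)).

Section Relations.
Context (N : nat).
Local Notation X := (@free_var K (hecke_index N)).
Implicit Types k m : hecke_index N.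

Variant hecke_relator : F N -> Prop :=
| Hecke_quadratic k :
    hecke_relator (X k ^+ 2 - (1 + (q - q^-1) *: X k))
| Hecke_braid k m of (`|sval k - sval m| = 1)%N :
    hecke_relator (X k * X m * X k - X m * X k * X m)
| Hecke_far k m of (2 <= `|sval k - sval m|)%N :
    hecke_relator (X k * X m - X m * X k).

Inductive hecke_ideal : F N -> Prop :=
| Hecke_ideal_relator r of hecke_relator r : hecke_ideal r
| Hecke_ideal0 : hecke_ideal 0
| Hecke_idealD x y of hecke_ideal x & hecke_ideal y : hecke_ideal (x + y)
| Hecke_idealMl a x of hecke_ideal x : hecke_ideal (a * x)
| Hecke_idealMr x a of hecke_ideal x : hecke_ideal (x * a).

Lemma hecke_idealN x : hecke_ideal x -> hecke_ideal (- x).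
Proof. by rewrite -mulN1r; apply: Hecke_idealMl. Qed.

Lemma hecke_idealZ c x : hecke_ideal x -> hecke_ideal (c *: x).
Proof. by rewrite -mulr_algl; apply: Hecke_idealMl. Qed.

Definition hecke_equiv (x y : F N) : bool := `[< hecke_ideal (x - y) >].

Lemma hecke_equivP x y : reflect (hecke_ideal (x - y)) (hecke_equiv x y).
Proof. exact: asboolP. Qed.

Lemma hecke_equiv_class : equiv_class_of hecke_equiv.
Proof.
split=> [x|x y|y x z]; first by apply/hecke_equivP; rewrite subrr; constructor.
  by apply/hecke_equivP/hecke_equivP => /hecke_idealN; rewrite opprB.
move=> /hecke_equivP xy /hecke_equivP yz; apply/hecke_equivP.
by rewrite -(subrKA y); apply: Hecke_idealD.
Qed.

Canonical hecke_equiv_equiv := EquivRelPack hecke_equiv_class.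
Canonical hecke_equiv_encModRel := defaultEncModRel hecke_equiv.

Definition hecke := {eq_quot hecke_equiv}.

HB.instance Definition _ : EqQuotient (F N) hecke_equiv hecke :=
  EqQuotient.on hecke.
HB.instance Definition _ := Choice.on hecke.

Lemma pi_heckeP (x y : F N) :
  reflect (hecke_ideal (x - y)) (\pi_hecke x == \pi_hecke y).
Proof. by rewrite piE; apply: hecke_equivP. Qed.

Lemma pi_hecke_eq (x y : F N) : hecke_ideal (x - y) -> \pi_hecke x = \pi_hecke y.
Proof. by move=> /pi_heckeP/eqP. Qed.

Lemma repr_heckeP (x : F N) : hecke_ideal (repr (\pi_hecke x) - x).
Proof. by apply/pi_heckeP; rewrite reprK. Qed.

Definition hecke_zero := lift_cst hecke 0.
Definition hecke_one := lift_cst hecke 1.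
Definition hecke_add := lift_op2 hecke +%R.
Definition hecke_opp := lift_op1 hecke -%R.
Definition hecke_mul := lift_op2 hecke *%R.
Definition hecke_scale (c : K) := lift_op1 hecke ( *:%R c).

Canonical pi_hecke_zero_morph := PiConst hecke_zero.
Canonical pi_hecke_one_morph := PiConst hecke_one.

Lemma pi_hecke_opp : {morph \pi_hecke : x / - x >-> hecke_opp x}.
Proof.
move=> x; unlock hecke_opp; apply: pi_hecke_eq.
by rewrite opprK addrC; apply: repr_heckeP.
Qed.
Canonical pi_hecke_opp_morph := PiMorph1 pi_hecke_opp.

Lemma pi_hecke_add : {morph \pi_hecke : x y / x + y >-> hecke_add x y}.
Proof.
move=> x y; unlock hecke_add; apply/esym/pi_hecke_eq.
by rewrite opprD addrACA; apply: Hecke_idealD; apply: repr_heckeP.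
Qed.
Canonical pi_hecke_add_morph := PiMorph2 pi_hecke_add.

Lemma pi_hecke_mul : {morph \pi_hecke : x y / x * y >-> hecke_mul x y}.
Proof.
move=> x y; unlock hecke_mul; apply/esym/pi_hecke_eq.
set x' := repr _; set y' := repr _.
have -> : x' * y' - x * y = (x' - x) * y' + x * (y' - y).
  by rewrite mulrBl mulrBr addrA subrK.
by apply: Hecke_idealD; [apply: Hecke_idealMr|apply: Hecke_idealMl];
   apply: repr_heckeP.
Qed.
Canonical pi_hecke_mul_morph := PiMorph2 pi_hecke_mul.

Lemma pi_hecke_scale c : {morph \pi_hecke : x / c *: x >-> hecke_scale c x}.
Proof.
move=> x; unlock hecke_scale; apply/esym/pi_hecke_eq.
by rewrite -scalerBr; apply/hecke_idealZ/repr_heckeP.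
Qed.
Canonical pi_hecke_scale_morph c := PiMorph1 (pi_hecke_scale c).

Lemma hecke_addA : associative hecke_add.
Proof. by move=> x y z; rewrite -[x]reprK -[y]reprK -[z]reprK !piE addrA. Qed.
Lemma hecke_addC : commutative hecke_add.
Proof. by move=> x y; rewrite -[x]reprK -[y]reprK !piE addrC. Qed.
Lemma hecke_add0 : left_id hecke_zero hecke_add.
Proof. by move=> x; rewrite -[x]reprK !piE add0r. Qed.
Lemma hecke_addN : left_inverse hecke_zero hecke_opp hecke_add.
Proof. by move=> x; rewrite -[x]reprK !piE addNr. Qed.

HB.instance Definition _ :=
  GRing.isZmodule.Build hecke hecke_addA hecke_addC hecke_add0 hecke_addN.

Section Evaluation.
Context (B : algType K) (h : hecke_index N -> B).

Definition hecke_rel_compatible : Prop :=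
  forall r, hecke_relator r -> free_eval h r = 0.

Lemma free_eval_ideal x :
  hecke_rel_compatible -> hecke_ideal x -> free_eval h x = 0.
Proof.
move=> hr; elim=> {x} [r /hr //||x y _ hx _ hy|a x _ hx|x a _ hx].
- by rewrite rmorph0.
- by rewrite rmorphD /= hx hy addr0.
- by rewrite rmorphM /= hx mulr0.
- by rewrite rmorphM /= hx mul0r.
Qed.

Lemma hecke_compatible :
  (forall k, h k ^+ 2 = 1 + (q - q^-1) *: h k) ->
  (forall k m, (`|sval k - sval m| = 1)%N -> h k * h m * h k = h m * h k * h m) ->
  (forall k m, (2 <= `|sval k - sval m|)%N -> h k * h m = h m * h k) ->
  hecke_rel_compatible.
Proof.
move=> h1 h2 h3 r [k|k m km|k m km]; rewrite rmorphB.
- rewrite rmorphXn rmorphD rmorph1 /= free_eval_scalable !free_eval_var.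
  by rewrite h1 subrr.
- apply/eqP; rewrite subr_eq0; apply/eqP.
  by apply: etrans (free_eval3 _ _ _ _) _; rewrite (h2 _ _ km) -free_eval3.
- apply/eqP; rewrite subr_eq0; apply/eqP.
  exact: etrans (free_eval2 _ _ _) (etrans (h3 _ _ km) (esym (free_eval2 _ _ _))).
Qed.

End Evaluation.

Lemma hecke_compatible_cst (B : algType K) (p : B) :
  p ^+ 2 = 1 + (q - q^-1) *: p -> hecke_rel_compatible (fun=> p).
Proof. by move=> hp; apply: hecke_compatible. Qed.

(* 1 is not in the ideal: use the representation R_k |-> q. *)
Lemma hecke_oner_neq0 : hecke_one != hecke_zero.
Proof.
have [p pP] : exists p : K^o, p ^+ 2 = 1 + (q - q^-1) *: p.
  have [q0|q0] := eqVneq q 0.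
    by exists 1; rewrite q0 invr0 subr0 scale0r addr0 expr1n.
  by exists q; rewrite /GRing.scale /= mulrBl mulVf // addrC subrK.
rewrite !piE; apply/hecke_equivP; rewrite subr0.
move=> /(free_eval_ideal (hecke_compatible_cst pP)).
by rewrite rmorph1 => /eqP; rewrite oner_eq0.
Qed.

Lemma hecke_mulA : associative hecke_mul.
Proof. by move=> x y z; rewrite -[x]reprK -[y]reprK -[z]reprK !piE mulrA. Qed.
Lemma hecke_mul1l : left_id hecke_one hecke_mul.
Proof. by move=> x; rewrite -[x]reprK !piE mul1r. Qed.
Lemma hecke_mul1r : right_id hecke_one hecke_mul.
Proof. by move=> x; rewrite -[x]reprK !piE mulr1. Qed.
Lemma hecke_mulDl : left_distributive hecke_mul hecke_add.
Proof. by move=> x y z; rewrite -[x]reprK -[y]reprK -[z]reprK !piE mulrDl. Qed.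
Lemma hecke_mulDr : right_distributive hecke_mul hecke_add.
Proof. by move=> x y z; rewrite -[x]reprK -[y]reprK -[z]reprK !piE mulrDr. Qed.

HB.instance Definition _ := GRing.Zmodule_isNzRing.Build hecke
  hecke_mulA hecke_mul1l hecke_mul1r hecke_mulDl hecke_mulDr hecke_oner_neq0.

Lemma hecke_scalerA a b x :
  hecke_scale a (hecke_scale b x) = hecke_scale (a * b) x.
Proof. by rewrite -[x]reprK !piE scalerA. Qed.
Lemma hecke_scale1r : left_id 1 hecke_scale.
Proof. by move=> x; rewrite -[x]reprK !piE scale1r. Qed.
Lemma hecke_scalerDr : right_distributive hecke_scale +%R.
Proof.
by move=> c x y; rewrite -[x]reprK -[y]reprK -[+%R]/hecke_add !piE scalerDr.
Qed.
Lemma hecke_scalerDl x : {morph hecke_scale^~ x : a b / a + b}.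
Proof.
by move=> a b; rewrite -[x]reprK -[_ + _ in RHS]/(hecke_add _ _) !piE scalerDl.
Qed.

HB.instance Definition _ := GRing.Zmodule_isLmodule.Build K hecke
  hecke_scalerA hecke_scale1r hecke_scalerDr hecke_scalerDl.

Lemma hecke_scalerAl (c : K) (x y : hecke) : c *: (x * y) = c *: x * y.
Proof.
rewrite -[LHS]/(hecke_scale c (hecke_mul x y)).
rewrite -[RHS]/(hecke_mul (hecke_scale c x) y).
by rewrite -[x]reprK -[y]reprK !piE scalerAl.
Qed.

HB.instance Definition _ := GRing.Lmodule_isLalgebra.Build K hecke hecke_scalerAl.

Lemma hecke_scalerAr (c : K) (x y : hecke) : c *: (x * y) = x * (c *: y).
Proof.
rewrite -[LHS]/(hecke_scale c (hecke_mul x y)).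
rewrite -[RHS]/(hecke_mul x (hecke_scale c y)).
by rewrite -[x]reprK -[y]reprK !piE free_scalerAr.
Qed.

HB.instance Definition _ := GRing.Lalgebra_isAlgebra.Build K hecke hecke_scalerAr.

(* The generator R_k for 0 < k < N; the value 0 at the other k is a dummy. *)
Definition heckeR (k : nat) : hecke :=
  if insub k is Some i then \pi_hecke (free_var i) else 0.

Definition heckeT (k : nat) : hecke := q^-1 *: 1 + heckeR k.

Lemma heckeRE (i : hecke_index N) : heckeR (sval i) = \pi_hecke (free_var i).
Proof. by rewrite /heckeR valK. Qed.

Lemma pi_heckeD x y : \pi_hecke (x + y) = \pi_hecke x + \pi_hecke y.
Proof. by rewrite -[RHS]/(hecke_add _ _) !piE. Qed.

Lemma pi_heckeM x y : \pi_hecke (x * y) = \pi_hecke x * \pi_hecke y.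
Proof. by rewrite -[RHS]/(hecke_mul _ _) !piE. Qed.

Lemma pi_heckeZ c x : \pi_hecke (c *: x) = c *: \pi_hecke x.
Proof. by rewrite -[RHS]/(hecke_scale _ _) !piE. Qed.

Lemma pi_hecke1 : \pi_hecke 1 = 1.
Proof. by rewrite -[RHS]/hecke_one !piE. Qed.

Lemma heckeR_quadratic (k : nat) : (0 < k < N)%N ->
  heckeR k ^+ 2 = 1 + (q - q^-1) *: heckeR k.
Proof.
move=> hk; rewrite -[k]/(sval (exist _ k hk : hecke_index N)) heckeRE.
rewrite expr2 -pi_heckeM -pi_heckeZ -pi_hecke1 -pi_heckeD.
by rewrite -expr2; apply/pi_hecke_eq/Hecke_ideal_relator/Hecke_quadratic.
Qed.

Lemma heckeR_braid (k m : nat) : (0 < k < N)%N -> (0 < m < N)%N -> (`|k - m| = 1)%N ->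
  heckeR k * heckeR m * heckeR k = heckeR m * heckeR k * heckeR m.
Proof.
move=> hk hm km; rewrite -[k]/(sval (exist _ k hk : hecke_index N)).
rewrite -[m]/(sval (exist _ m hm : hecke_index N)) !heckeRE -!pi_heckeM.
exact/pi_hecke_eq/Hecke_ideal_relator/Hecke_braid.
Qed.

Lemma heckeR_far (k m : nat) : (0 < k < N)%N -> (0 < m < N)%N -> (2 <= `|k - m|)%N ->
  heckeR k * heckeR m = heckeR m * heckeR k.
Proof.
move=> hk hm km; rewrite -[k]/(sval (exist _ k hk : hecke_index N)).
rewrite -[m]/(sval (exist _ m hm : hecke_index N)) !heckeRE -!pi_heckeM.
exact/pi_hecke_eq/Hecke_ideal_relator/Hecke_far.
Qed.

End Relations.

(* The algebra morphism H_M -> H_N, R_k |-> R_k, for M <= N. *)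
Definition hecke_incl (M N : nat) (_ : (M <= N)%N) (x : hecke M) : hecke N :=
  free_eval (fun k : hecke_index M => heckeR N (sval k)) (repr x).

Section Inclusion.
Context (M N : nat) (leMN : (M <= N)%N).
Local Notation hecke_incl := (hecke_incl leMN).

Lemma hecke_incl_index (k : hecke_index M) : (0 < sval k < N)%N.
Proof. by case/andP: (valP k) => -> /leq_trans->. Qed.

Lemma hecke_incl_compatible :
  hecke_rel_compatible (fun k : hecke_index M => heckeR N (sval k)).
Proof.
apply: hecke_compatible => [k|k m|k m].
- by apply: heckeR_quadratic; apply: hecke_incl_index.
- by apply: heckeR_braid; apply: hecke_incl_index.
- by apply: heckeR_far; apply: hecke_incl_index.
Qed.

Lemma hecke_incl_pi (x : F M) : hecke_incl (\pi_(hecke M) x) =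
  free_eval (fun k : hecke_index M => heckeR N (sval k)) x.
Proof.
apply/eqP; rewrite -subr_eq0 -rmorphB; apply/eqP.
exact: free_eval_ideal hecke_incl_compatible (repr_heckeP x).
Qed.

Lemma hecke_incl_linear : linear hecke_incl.
Proof.
move=> c x y; rewrite -[x]reprK -[y]reprK -pi_heckeZ -pi_heckeD !hecke_incl_pi.
by rewrite rmorphD /= free_eval_scalable.
Qed.

HB.instance Definition _ :=
  GRing.isLinear.Build K (hecke M) (hecke N) _ hecke_incl hecke_incl_linear.

Lemma hecke_incl_monoid : monoid_morphism hecke_incl.
Proof.
split=> [|x y]; first by rewrite -pi_hecke1 hecke_incl_pi rmorph1.
rewrite -[x]reprK -[y]reprK -pi_heckeM !hecke_incl_pi.
exact: free_evalM.
Qed.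

HB.instance Definition _ :=
  GRing.isMonoidMorphism.Build (hecke M) (hecke N) hecke_incl hecke_incl_monoid.

Lemma hecke_inclR k : (k < M)%N -> hecke_incl (heckeR M k) = heckeR N k.
Proof.
move=> kM; case: k kM => [|k] kM.
  by rewrite /heckeR !insubF ?linear0.
have hk : (0 < k.+1 < M)%N by [].
rewrite -[k.+1]/(sval (exist _ k.+1 hk : hecke_index M)) heckeRE hecke_incl_pi.
exact: free_eval_var.
Qed.

End Inclusion.

(* The antisymmetrizer P_N; P_0 = 1 is a dummy. *)
Fixpoint qantisym (N : nat) : hecke N :=
  match N with
  | 0 => 1
  | M.+1 =>
    if M is 0 then 1 else
    let PM := hecke_incl (leqnSn M) (qantisym M) in
    (qnum M.+1)^-1 *: (PM * (q ^+ M *: 1 - qnum M *: heckeR M.+1 M) * PM)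
  end.

End Hecke.

(* C(q), with C = R[i]. *)
Definition Cq (R : realType) : fieldType := {fraction {poly R[i]}}.

Definition indet_q (R : realType) : Cq R := tofrac ('X : {poly R[i]}).

(* Main.v *)
Require Import Defs.
From mathcomp Require Import all_boot all_order all_algebra reals.
From mathcomp Require Import zify ring.

(* Write a = T_(N-1), b = T_N, p = P_(N-1), d = [2] and P_N = p - c p a p. Since p is
   idempotent and commutes with b, both sides are combinations of b p and
   p b a b p, once b a b a b = (d^2 + 1) b a b - d^2 b is known from b^2 = d b,
   a^2 = d a and b a b = a b a - a + b. Idempotency is proved together with
   T_k P_n = 0 for k < n; the key step is T_n P_n T_n P_n = [n+1]/[n] T_n P_n. *)

Import GRing.Theory.
Local Open Scope ring_scope.

(** * Quantum integers at a [q] that is not a root of unity *)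

Section QuantumIntegers.
Context (K : fieldType) (q : K).
Hypotheses (q0 : q != 0) (q_free : forall n, (0 < n)%N -> q ^+ n != 1).

Lemma quantum_den_neq0 : q - q^-1 != 0.
Proof.
apply: contraNneq (q_free 2 isT) => h.
by rewrite expr2 -{2}[q](subrK q^-1) h add0r divff.
Qed.

Lemma qnumE (n : nat) : qnum q n = (q ^+ n - (q ^+ n)^-1) / (q - q^-1).
Proof. by rewrite /qnum -exprnN. Qed.

Lemma qnum0 : qnum q 0 = 0.
Proof. by rewrite (qnumE 0) expr0 invr1 subrr mul0r. Qed.

Lemma qnum1 : qnum q 1 = 1.
Proof. by rewrite (qnumE 1) expr1 divff ?quantum_den_neq0. Qed.

Lemma qnum2 : qnum q 2 = q + q^-1.
Proof.
rewrite (qnumE 2); apply: canLR (mulfK quantum_den_neq0) _.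
by field.
Qed.

(** A zero would force [q ^+ (2 * n.+1) = 1]. *)
Lemma qnum_neq0 (n : nat) : qnum q n.+1 != 0.
Proof.
rewrite qnumE mulf_neq0 ?invr_eq0 ?quantum_den_neq0 // subr_eq0.
have qn0 : q ^+ n.+1 != 0 by rewrite expf_neq0.
apply: contraNneq (q_free (n.+1 + n.+1)%N isT) => h.
by rewrite exprD {2}h divff.
Qed.

Lemma qnumSS (n : nat) : qnum q n.+2 = qnum q 2 * qnum q n.+1 - qnum q n.
Proof.
rewrite qnum2 !qnumE !exprS.
have qn0 : q ^+ n != 0 by rewrite expf_neq0.
have d1 : q * q - 1 != 0.
  by rewrite subr_eq0 -expr2 (q_free 2 isT).
by field; rewrite q0 d1 qn0.
Qed.

Lemma qnumS (n : nat) : qnum q n.+1 = q ^+ n + q^-1 * qnum q n.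
Proof.
rewrite !qnumE exprS.
have qn0 : q ^+ n != 0 by rewrite expf_neq0.
have d1 : q * q - 1 != 0.
  by rewrite subr_eq0 -expr2 (q_free 2 isT).
by field; rewrite q0 d1 qn0.
Qed.

End QuantumIntegers.

(** * Antisymmetrizers and the relation in any algebra satisfying the relations of the [T k] *)

Section BraidAlgebra.
Context (K : fieldType) (q : K) (B : algType K) (M : nat) (T : nat -> B).
Hypotheses (q0 : q != 0) (q_free : forall n, (0 < n)%N -> q ^+ n != 1).
Hypothesis T_quadratic :
  forall k, (0 < k < M)%N -> T k * T k = qnum q 2 *: T k.
Hypothesis T_braid : forall k, (0 < k)%N -> (k.+1 < M)%N ->
  T k.+1 * T k * T k.+1 = T k * T k.+1 * T k - T k + T k.+1.
Hypothesis T_far : forall k m, (0 < k)%N -> (k.+1 < m < M)%N ->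
  GRing.comm (T m) (T k).

Local Notation num n := (qnum q (n%N)%:Z).

(** All antisymmetrizers live in one algebra [B], so no inclusions occur. The unspecified [T 0]
    enters only with the coefficient [num 0 / num 1 = 0]. *)
Fixpoint antisym (n : nat) : B :=
  if n is m.+1 then
    antisym m - (num m / num m.+1) *: (antisym m * T m * antisym m)
  else 1.

Lemma antisym1 : antisym 1 = 1.
Proof. by rewrite /= qnum0 mul0r scale0r subr0. Qed.

Lemma antisymS n :
  antisym n.+1 =
  antisym n - (num n / num n.+1) *: (antisym n * T n * antisym n).
Proof. by []. Qed.

Lemma antisym_comm n m : (n < m < M)%N -> GRing.comm (T m) (antisym n).
Proof.
elim: n => [|n IHn] /andP[nm mM]; first exact: commr1.
have IH : GRing.comm (T m) (antisym n) by apply: IHn; rewrite mM (ltnW nm).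
case: n IH {IHn} nm => [|n] IH nm; first by rewrite antisym1; apply: commr1.
rewrite antisymS; apply: commrB => //.
rewrite /GRing.comm -scalerAr -scalerAl; congr (_ *: _).
by apply: commrM => //; apply: commrM => //; apply: T_far; rewrite ?nm ?mM.
Qed.

Lemma antisymMS n :
  antisym n * antisym n = antisym n -> antisym n * antisym n.+1 = antisym n.+1.
Proof. by move=> h; rewrite antisymS mulrBr -scalerAr !mulrA h. Qed.

(** The induction is strong: the step to [n.+2] uses idempotency at both [n] and [n.+1], the former
    through [antisymMS]. *)
Lemma antisym_idem_annihil n : (n <= M)%N ->
  antisym n * antisym n = antisym n /\
  (forall k, (0 < k < n)%N -> T k * antisym n = 0).
Proof.
elim/ltn_ind: n => -[|[|n]] IH nM.
- by split=> [|k]; [rewrite mulr1 | rewrite ltn0 andbF].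
- by rewrite antisym1 mulr1; split=> // -[|k].
have [idem0 _] := IH n (ltnW (ltnSn _)) (ltnW (ltnW nM)).
have [idem annihil] := IH n.+1 (ltnSn _) (ltnW nM).
have PP := antisymMS n idem0.
(* Expanding the inner [antisym n.+1] gives the scalar [num 2 - num n / num n.+1], which the
   three-term recurrence turns into [num n.+2 / num n.+1]. *)
have TPTP : T n.+1 * antisym n.+1 * T n.+1 * antisym n.+1 =
    (num n.+2 / num n.+1) *: (T n.+1 * antisym n.+1).
  have bP : GRing.comm (T n.+1) (antisym n).
    by apply: antisym_comm; rewrite ltnSn.
  have b2 : T n.+1 * T n.+1 = num 2 *: T n.+1 by apply: T_quadratic.
  have tail : T n.+1 * antisym n * T n.+1 * antisym n.+1 =
      num 2 *: (T n.+1 * antisym n.+1).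
    by rewrite -(mulrA (T n.+1)) -bP mulrA b2 -!scalerAl -mulrA PP.
  case: n nM {IH idem idem0 b2} annihil PP bP tail => [|n] nM annihil PP bP tail.
    move: tail; rewrite antisym1 mulr1 => ->.
    by rewrite qnum1 // divr1.
  (* After the braid relation, [T n.+1] kills [antisym n.+2] in every term but the last. *)
  have bab : T n.+2 * T n.+1 * T n.+2 * antisym n.+2 = T n.+2 * antisym n.+2.
    rewrite T_braid // mulrDl mulrBl -!mulrA (annihil n.+1) ?ltnSn // !mulr0.
    by rewrite subr0 add0r.
  have mid : T n.+2 * (antisym n.+1 * T n.+1 * antisym n.+1) * T n.+2 *
      antisym n.+2 = T n.+2 * antisym n.+2.
    rewrite 2!mulrA bP -!mulrA.
    rewrite [antisym n.+1 * (T n.+2 * antisym n.+2)]mulrA -bP -mulrA PP.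
    by move: bab; rewrite -!mulrA => ->; rewrite mulrA -bP -mulrA PP.
  (* Generalized, since ring rewriting would match inside the unfolded fixpoint. *)
  move: (antisymS n.+1) mid tail.
  move: (antisym n.+1) (antisym n.+2) => p P PE mid tail.
  rewrite [X in T n.+2 * X * _ * _ = _]PE mulrBr -scalerAr !mulrBl -!scalerAl.
  rewrite mid tail -scalerBl.
  congr (_ *: _); rewrite (qnumSS _ _ q0 q_free n.+1) mulrBl mulfK //.
  exact: qnum_neq0.
have TP k : (0 < k < n.+2)%N -> T k * antisym n.+2 = 0.
  case/andP=> k0; rewrite ltnS leq_eqVlt => /orP[/eqP->|kn].
    (* The scalar of [TPTP] is inverse to the coefficient in the recursion, so the two terms
       cancel. *)
    rewrite antisymS mulrBr -scalerAr !mulrA TPTP scalerA.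
    by rewrite mulrA mulfVK ?mulfV ?qnum_neq0 // scale1r subrr.
  by rewrite antisymS mulrBr -scalerAr !mulrA annihil ?k0 // !mul0r scaler0 subr0.
split=> //.
rewrite {1}antisymS mulrBl -scalerAl -!mulrA antisymMS //.
by rewrite TP ?ltnSn // mulr0 scaler0 subr0.
Qed.

Lemma antisym_relation n : (1 < n)%N -> (n < M)%N ->
  (num 2 ^+ 2 + 1) *: (T n * antisym n * T n) =
    (num 2 * (num n.+2 + 2 * num n) / num n) *: (T n * antisym n.-1)
    - (num n.-1 / num n) *:
        (antisym n.-1 * T n * T n.-1 * T n * T n.-1 * T n * antisym n.-1).
Proof.
case: n => [|[|n]] // _ nM; rewrite -[n.+2.-1]/n.+1.
set a := T n.+1; set b := T n.+2; set p := antisym n.+1; set d := num 2.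
have [pp _] := antisym_idem_annihil n.+1 (ltnW (ltnW nM)); rewrite -/p in pp.
have bp : GRing.comm b p by apply: antisym_comm; rewrite ltnSn.
have bb : b * b = d *: b by apply: T_quadratic.
have bab : b * a * b = a * b * a - a + b by apply: T_braid.
have aa : a * a = d *: a by apply: T_quadratic; rewrite (ltnW nM).
(* Two reductions lead to [d ^+ 2 *: (a * b * a - a) + b * a * b]; the braid relation gives
   [a * b * a - a = b * a * b - b]. *)
have babab : b * a * b * a * b = (d ^+ 2 + 1) *: (b * a * b) - d ^+ 2 *: b.
  have baba : b * a * b * a = d *: (a * b * a - a) + b * a.
    by rewrite bab mulrDl mulrBl -!mulrA aa -!scalerAr scalerBr !mulrA.
  have abab : a * b * a * b = d *: (a * b * a - a) + a * b.
    by rewrite -!mulrA (mulrA b) bab mulrDr mulrBr !mulrA aa -!scalerAl scalerBr.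
  rewrite baba mulrDl -scalerAl mulrBl abab addrK scalerA -expr2.
  rewrite scalerDl scale1r -addrA [_ - _ *: b]addrC addrA -scalerBr; congr (_ + _).
  by rewrite bab addrK.
have outer : b * antisym n.+2 * b =
    d *: (b * p) - (num n.+1 / num n.+2) *: (p * (b * a * b) * p).
  have bpb : b * p * b = d *: (b * p) by rewrite bp -mulrA bb -scalerAr.
  have bpapb : b * (p * a * p) * b = p * (b * a * b) * p.
    by rewrite !mulrA bp -!mulrA bp.
  rewrite antisymS -/p -/a; move: (p) bpb bpapb => r bpb bpapb.
  by rewrite mulrBr mulrBl bpb -scalerAr -!scalerAl bpapb.
move: (p) bp pp outer => {}p bp pp outer.
have inner : p * b * a * b * a * b * p =
    (d ^+ 2 + 1) *: (p * (b * a * b) * p) - d ^+ 2 *: (b * p).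
  have -> : p * b * a * b * a * b * p = p * (b * a * b * a * b) * p.
    by rewrite !mulrA.
  rewrite babab mulrBr mulrBl -!scalerAr -!scalerAl; congr (_ - _ *: _).
  by rewrite -bp -mulrA pp.
(* The coefficients of [X] and [Y] are compared separately. For [X], two uses of the recurrence
   express [num n.+4] through [d], [num n.+2] and [num n.+1]. *)
rewrite outer inner; move: (b * p) (p * _ * p) => X Y.
rewrite !scalerBr !scalerA opprB addrA -scalerDl.
congr (_ *: _ - _ *: _); last by rewrite mulrC.
rewrite (qnumSS _ _ q0 q_free n.+2) (qnumSS _ _ q0 q_free n.+1) -/d.
by field; apply: qnum_neq0.
Qed.

End BraidAlgebra.

Arguments antisym {K} q {B} T n.
Arguments antisymS {K} q {B} T n.

(** * Transfer to the Hecke algebras *)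

Section HeckeAntisymmetrizer.
Context (K : fieldType) (q : K).
Hypotheses (q0 : q != 0) (q_free : forall n, (0 < n)%N -> q ^+ n != 1).

Lemma heckeT_quadratic M k : (0 < k < M)%N ->
  heckeT q M k * heckeT q M k = qnum q 2 *: heckeT q M k.
Proof.
move=> /(heckeR_quadratic q); rewrite expr2 => RR; rewrite /heckeT.
rewrite mulrDl !mulrDr RR -!scalerAl -!scalerAr !mul1r !mulr1 scalerDr !scalerA.
rewrite qnum2 // [(q + _) * _]mulrDl mulfV // !scalerDl scale1r scaleNr.
move: (_ *: 1) (q^-1 *: _) (q *: _) => x y z.
rewrite [1 + (z - y)]addrA [y + _]addrC subrK [1 + x]addrC -!addrA.
congr (_ + _); rewrite addrCA; congr (_ + _); exact: addrC.
Qed.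

Lemma heckeT_braid M k : (0 < k)%N -> (k.+1 < M)%N ->
  heckeT q M k.+1 * heckeT q M k * heckeT q M k.+1 =
  heckeT q M k * heckeT q M k.+1 * heckeT q M k
  - heckeT q M k + heckeT q M k.+1.
Proof.
move=> k0 kM.
have hk : (0 < k < M)%N by rewrite k0 ltnW.
have hk1 : (0 < k.+1 < M)%N by [].
have dist : (`|k - k.+1| = 1)%N by lia.
have Rk := heckeR_quadratic q hk; have Rk1 := heckeR_quadratic q hk1.
have braid := heckeR_braid q hk hk1 dist.
rewrite /heckeT; move: (heckeR q M k) (heckeR q M k.+1) Rk Rk1 braid => x y.
rewrite !expr2 => xx yy xyx.
set c := q^-1.
(* [sym] gathers the terms of the expanded triple product that are invariant under exchanging [u]
   and [v]; these cancel between the two sides. *)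
pose sym (u v : hecke q M) :=
  (c * (c * c)) *: 1 + (c * c) *: (u + v) + c *: (u * v + v * u).
have expand u v : (c *: 1 + v) * (c *: 1 + u) * (c *: 1 + v) =
    sym u v + c *: (c *: v + v * v) + v * u * v.
  rewrite /sym !mulrDr !mulrDl -!scalerAr -!scalerAl !mulr1 !mul1r.
  rewrite !scalerDr !scalerA.
  by rewrite [LHS](AC ((2*2)*(2*2)) ((1*(3*2))*(7*4)*(5*6)*8)).
have symC u v : sym u v = sym v u.
  by rewrite /sym [u + v]addrC [_ * _ + _]addrC.
(* The asymmetric remainder is again a [T], which accounts for the linear terms of the relation. *)
have quad u : u * u = 1 + (q - c) *: u -> c *: (c *: u + u * u) = c *: 1 + u.
  move=> ->; rewrite addrCA -scalerDl [c + _]addrC subrK scalerDr scalerA mulVf //.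
  by rewrite scale1r.
rewrite !expand !quad // xyx symC; move: (sym _ _) (_ * _ * _) => s z.
by rewrite [s + (_ + x) + z]addrAC addrK addrAC.
Qed.

Lemma heckeT_far M k m : (0 < k)%N -> (k.+1 < m < M)%N ->
  GRing.comm (heckeT q M m) (heckeT q M k).
Proof.
move=> k0 /andP[km mM].
have RR : GRing.comm (heckeR q M m) (heckeR q M k).
  by apply: heckeR_far; lia.
have scal (z : hecke q M) : GRing.comm z (q^-1 *: 1).
  by rewrite /GRing.comm -scalerAr mulr1 -scalerAl mul1r.
apply: commrD; first exact: scal.
by apply/commr_sym/commrD; [apply: scal | apply: commr_sym].
Qed.

Lemma hecke_inclT M N (leMN : (M <= N)%N) k : (k < M)%N ->
  hecke_incl leMN (heckeT q M k) = heckeT q N k.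
Proof. by move=> kM; rewrite linearD linearZ rmorph1 /= hecke_inclR. Qed.

Lemma hecke_incl_antisym M N (leMN : (M <= N)%N) n : (n <= M)%N ->
  hecke_incl leMN (antisym q (heckeT q M) n) = antisym q (heckeT q N) n.
Proof.
elim: n => [|n IHn] nM; first exact: rmorph1.
by rewrite !antisymS linearB linearZ /= !rmorphM /= IHn ?hecke_inclT // ltnW.
Qed.

(** Quantifying over the target [M] lets the induction hypothesis apply to the inclusion inside the
    recursion of [qantisym]. *)
Lemma hecke_incl_qantisym N M (leNM : (N <= M)%N) :
  hecke_incl leNM (qantisym q N) = antisym q (heckeT q M) N.
Proof.
elim: N M leNM => [|[|N] IHN] M leNM; first exact: rmorph1.
  by rewrite antisym1; apply: rmorph1.
have -> : qantisym q N.+2 = antisym q (heckeT q N.+2) N.+2.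
  rewrite antisymS -(IHN _ (leqnSn N.+1)) /=.
  set p := hecke_incl _ _.
  have pp : p * p = p.
    rewrite /p IHN.
    have [] // := @antisym_idem_annihil _ q _ N.+2 (heckeT q N.+2) q0 q_free _ _ _ N.+1.
    - exact: heckeT_quadratic.
    - exact: heckeT_braid.
    - exact: heckeT_far.
  (* By [qnumS], passing from R to T changes the constant to [qnum q N.+2]; with [p * p = p] this
     yields the recursion of [antisym]. *)
  have -> : (q ^+ N.+1)%:A - qnum q N.+1 *: heckeR q N.+2 N.+1 =
      (qnum q N.+2)%:A - qnum q N.+1 *: heckeT q N.+2 N.+1.
    rewrite /heckeT (qnumS _ _ q0 q_free N.+1) scalerDr scalerDl scalerA opprD addrA.
    by rewrite [_ * q^-1]mulrC addrK.
  rewrite mulrBr mulrBl -!scalerAr -!scalerAl mulr1 pp scalerBr !scalerA.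
  by rewrite mulVf ?qnum_neq0 // scale1r [_ / _]mulrC.
exact: hecke_incl_antisym.
Qed.

End HeckeAntisymmetrizer.

(** * The indeterminate is nonzero and not a root of unity *)

Lemma indet_q_neq0 (R : realType) : indet_q R != 0.
Proof. by rewrite tofrac_eq0 polyX_eq0. Qed.

Lemma tofracX_free (D : idomainType) n :
  (0 < n)%N -> (tofrac ('X : {poly D})) ^+ n != 1.
Proof.
move=> n0; rewrite -tofracXn -tofrac1 tofrac_eq.
apply: contraTneq n0 => /(congr1 (fun p : {poly D} => size p)).
by rewrite size_polyXn size_poly1 => -[->].
Qed.

Lemma indet_q_free (R : realType) n : (0 < n)%N -> indet_q R ^+ n != 1.
Proof. exact: tofracX_free. Qed.

Theorem proposition2 (R : realType) (N : nat) (N_ge2 : (2 <= N)%N) :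
  let q := indet_q R in
  let num (k : int) := qnum q k in
  let T k : hecke q N.+1 := heckeT q N.+1 k in
  let P_N : hecke q N.+1 := hecke_incl (leqnSn N) (qantisym q N) in
  let P_N1 : hecke q N.+1 := hecke_incl (leqW (leq_pred N)) (qantisym q N.-1) in
  (num 2 ^+ 2 + 1) *: (T N * P_N * T N) =
    (num 2 * (num (N%:Z + 2) + 2 * num N%:Z) / num N%:Z) *: (T N * P_N1)
    - (num (N%:Z - 1) / num N%:Z) *:
        (P_N1 * T N * T N.-1 * T N * T N.-1 * T N * P_N1).
Proof.
move=> q num T P_N P_N1; rewrite /P_N /P_N1.
have q0 : q != 0 := indet_q_neq0 R.
have q_free := indet_q_free R : forall n, (0 < n)%N -> q ^+ n != 1.
(* Both included antisymmetrizers become values of [antisym] in the algebra [hecke q N.+1]. *)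
rewrite !hecke_incl_qantisym //.
have -> : N%:Z + 2 = (N.+2)%N%:Z by lia.
have -> : N%:Z - 1 = (N.-1)%N%:Z by lia.
apply: (antisym_relation _ _ _ N.+1 _ q0 q_free) => //.
- exact: (heckeT_quadratic _ _ q0 q_free).
- exact: (heckeT_braid _ _ q0).
- exact: heckeT_far.
Qed.
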